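(* Let $W$ be a linear space over $\mathbb{K}\in\{\mathbb{R},\mathbb{C}\}$, let $0<q\le 1$, let $V\neq\{0\}$ be a $W$-spreading $q$-space, let $\Omega$ be a nonempty set and let $A$ be an $(\Omega,V)$-stable function space. Let $\mathcal{N}=\{f\in A: f \text{ is not injective}\}$. Then either $\mathcal{N}=\{0\}$ or $\mathcal{N}$ is pointwise spaceable in $A$, i.e., for every $f\in\mathcal{N}$ there is a closed $\mathfrak{c}$-dimensional (in particular infinite dimensional) linear subspace $X$ of $A$ with $f\in X\subseteq\mathcal{N}$.
   Context: For $0<q\le 1$, a $q$-norm on a linear space $X$ is a map $\|\cdot\|\colon X\to[0,\infty)$ with $\|x\|=0$ iff $x=0$, $\|\lambda x\|=|\lambda|\,\|x\|$, and $\|x+y\|^q\le\|x\|^q+\|y\|^q$; a $q$-Banach space is a space with a complete $q$-norm. $\mathfrak{c}$ is the cardinality of the continuum. A $W$-spreading $q$-space is a linear subspace $V$ of the space $W^{\mathbb{N}}$ of $W$-valued sequences (coordinatewise operations) endowed with a complete $q$-norm $\|\cdot\|_V$ such that: whenever $(a_j)_{j=1}^\infty\in V$ and $\mathbb{N}_0=\{j_1<j_2<\cdots\}$ is an infinite subset of $\mathbb{N}$, the sequence $(b_k)_{k}$ with $b_k=a_i$ if $k=j_i$ and $b_k=0$ if $k\notin\mathbb{N}_0$ belongs to $V$ and $\|(b_k)_k\|_V\le\|(a_j)_j\|_V$. For a nonempty set $\Omega$ and a $q$-Banach space $F$, an $(\Omega,F)$-stable function space is a linear subspace $A\neq\{0\}$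 of the space $F^\Omega$ of all maps $\Omega\to F$ (pointwise operations), endowed with a complete $q$-norm $\|\cdot\|_A$, such that: (i) the topology induced by $\|\cdot\|_A$ contains (is finer than) the topology of pointwise convergence on $A$; (ii) for every $g\in A$ and every bounded linear operator $u\colon F\to F$, one has $u\circ g\in A$ and $\|u\circ g\|_A\le\|u\|\,\|g\|_A$. *)

(* Defs.v *)
From mathcomp Require Import all_boot all_algebra.
From mathcomp Require Import all_classical all_reals all_analysis.
From mathcomp Require Import complex.
Import GRing.Theory Num.Theory.
Local Open Scope ring_scope.
Local Open Scope classical_set_scope.

Set Implicit Arguments.
Unset Strict Implicit.
Unset Printing Implicit Defensive.

Definition KK (R : realType) (b : bool) : numFieldType :=
  if b then (R : numFieldType) else ((R[i])%C : numFieldType).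

Definition modK (R : realType) (b : bool) : KK R b -> R :=
  match b return KK R b -> R with
  | true => fun x : R => `|x|
  | false => fun z : R[i] => let: Complex a c := z in Num.sqrt (a ^+ 2 + c ^+ 2)
  end.

Section Defs.
Variables (R : realType) (b : bool).
Local Notation K := (KK R b).

Definition is_subspace (T : lmodType K) (P : set T) : Prop :=
  P 0 /\ (forall x y, P x -> P y -> P (x + y)) /\
  (forall (l : K) x, P x -> P (l *: x)).

(* nrm is a q-norm on the linear space P (values outside P irrelevant) *)
Definition is_qnorm (T : lmodType K) (P : set T) (q : R) (nrm : T -> R) : Prop :=
  (forall x, P x -> 0 <= nrm x) /\
  (forall x, P x -> (nrm x = 0 <-> x = 0)) /\
  (forall (l : K) x, P x -> nrm (l *: x) = modK l * nrm x) /\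
  (forall x y, P x -> P y ->
     powR (nrm (x + y)) q <= powR (nrm x) q + powR (nrm y) q).

Definition is_complete (T : lmodType K) (P : set T) (nrm : T -> R) : Prop :=
  forall u : nat -> T, (forall n, P (u n)) ->
   (forall e : R, 0 < e -> exists N : nat, forall m n : nat,
        (N <= m)%N -> (N <= n)%N -> nrm (u m - u n) < e) ->
   exists l, P l /\
     (forall e : R, 0 < e -> exists N : nat, forall n : nat,
        (N <= n)%N -> nrm (u n - l) < e).

Definition is_qBanach (T : lmodType K) (P : set T) (q : R) (nrm : T -> R) : Prop :=
  is_subspace P /\ is_qnorm P q nrm /\ is_complete P nrm.

Definition spreading_qspace (W : lmodType K) (q : R)
    (V : set (nat -> W)) (nV : (nat -> W) -> R) : Prop :=
  is_qBanach V q nV /\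
  forall (a : nat -> W), V a ->
  forall (j : nat -> nat), (forall i, (j i < j i.+1)%N) ->
  forall bb : nat -> W,
    (forall i, bb (j i) = a i) -> (forall k, (forall i, j i <> k) -> bb k = 0) ->
    V bb /\ nV bb <= nV a.

Definition bounded_linear_op (W : lmodType K) (V : set (nat -> W))
    (nV : (nat -> W) -> R) (u : (nat -> W) -> (nat -> W)) : Prop :=
  (forall x, V x -> V (u x)) /\
  (forall x y, V x -> V y -> u (x + y) = u x + u y) /\
  (forall (l : K) x, V x -> u (l *: x) = l *: u x) /\
  has_ubound [set nV (u x) | x in [set x | V x /\ nV x <= 1]].

Definition opnorm (W : lmodType K) (V : set (nat -> W))
    (nV : (nat -> W) -> R) (u : (nat -> W) -> (nat -> W)) : R :=
  sup [set nV (u x) | x in [set x | V x /\ nV x <= 1]].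

Definition stable_function_space (W : lmodType K) (q : R)
    (V : set (nat -> W)) (nV : (nat -> W) -> R) (Om : Type)
    (A : set (Om -> nat -> W)) (nA : (Om -> nat -> W) -> R) : Prop :=
  (forall g, A g -> forall w, V (g w)) /\
  is_qBanach A q nA /\
  (exists g, A g /\ g <> 0) /\
  (* (i) the norm topology on A is finer than the topology of pointwise
     convergence, i.e. each evaluation g |-> g w is continuous A -> F *)
  (forall (w : Om) g, A g -> forall e : R, 0 < e -> exists d : R, 0 < d /\
     forall h, A h -> nA (h - g) < d -> nV (h w - g w) < e) /\
  (forall g, A g -> forall u, bounded_linear_op V nV u ->
     A (u \o g) /\ nA (u \o g) <= opnorm V nV u * nA g).

(* X is a closed linear subspace of (A, nA) of (Hamel) dimension c:
   it has a Hamel basis indexed injectively by R, which has cardinality c *)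
Definition closed_c_dim_subspace (T : lmodType K) (A : set T) (nA : T -> R)
    (X : set T) : Prop :=
  X `<=` A /\ is_subspace X /\
  (forall (u : nat -> T) (y : T), (forall n, X (u n)) -> A y ->
     (forall e : R, 0 < e -> exists N : nat, forall n : nat,
        (N <= n)%N -> nA (u n - y) < e) -> X y) /\
  exists e : R -> T,
    injective e /\
    (forall (s : seq R) (c : R -> K), uniq s ->
       \sum_(i <- s) c i *: e i = 0 -> forall i, i \in s -> c i = 0) /\
    (forall x, X x <-> exists (s : seq R) (c : R -> K), x = \sum_(i <- s) c i *: e i).

End Defs.

(* Main.v *)
(** Let [f w1 = f w2] with [f <> 0]. Any closed subspace of
    [{h in A | h w1 = h w2}] consists of non-injective functions, so it suffices
    to find one that contains [f] and has dimension exactly the continuum. Let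
    [S_n] be the contraction of [V] that spreads a sequence along the set of
    numbers [2^n (2 i + 1)], and let [X] be the closure of the span of [f] and
    all [S_n o f]. For [0 < t < 1] the functions [sum_n t^n S_n o f] lie in [X]
    and are linearly independent: the [S_n o f] have disjoint supports, hence a
    linear relation would make all power sums of the parameters vanish. Conversely
    [X] is separable, so it has at most continuum many points, and a Hamel basis
    containing the family above has exactly that cardinality. *)

Require Import Defs.
From mathcomp Require Import all_boot all_algebra.
From mathcomp Require Import all_classical all_reals all_analysis.
From mathcomp Require Import complex ring lra zify.
Import order.Order.TTheory GRing.Theory Num.Theory.
Local Open Scope ring_scope.
Local Open Scope classical_set_scope.

Set Implicit Arguments.
Unset Strict Implicit.
Unset Printing Implicit Defensive.

(** * Injecting subsets of countable sets and arrays of scalars into the reals *)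

Section ContinuumCard.
Variable R : realType.

(** Digits 0 and 1 are read in base 3, which avoids the double expansions of base 2. *)
Definition ternary_partial (S : set nat) (n : nat) : R :=
  \sum_(i < n | `[< S i >]) 3^-1 ^+ i.

Definition ternary (S : set nat) : R := sup (range (ternary_partial S)).

Lemma ternary_partialS (S : set nat) n :
  ternary_partial S n.+1 =
  ternary_partial S n + (if `[< S n >] then 3^-1 ^+ n else 0).
Proof. by rewrite /ternary_partial !(big_mkcond (fun i => `[< S _ >])) big_ord_recr. Qed.

(** The factor 3/2 is 1 / (1 - 1/3): the upper bound adds the full geometric sum of the weights at
    the places from [n] to [n + k - 1]. *)
Lemma ternary_partial_tail (S : set nat) n k :
  ternary_partial S n <= ternary_partial S (n + k) <=
  ternary_partial S n + 3 / 2 * (3^-1 ^+ n - 3^-1 ^+ (n + k)).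
Proof.
elim: k => [|k IH]; first by rewrite addn0 subrr mulr0 addr0 lexx.
rewrite addnS ternary_partialS exprS.
have : 0 <= (3^-1 : R) ^+ (n + k) by rewrite exprn_ge0// invr_ge0.
move/andP: IH => [].
move: (3^-1 ^+ (n + k)) (3^-1 ^+ n) (ternary_partial S n) (ternary_partial S (n + k)) => *.
by apply/andP; split; case: ifP => _; lra.
Qed.

Lemma ternary_bounds (S : set nat) n :
  ternary_partial S n <= ternary S <= ternary_partial S n + 3 / 2 * 3^-1 ^+ n.
Proof.
have ub : ubound (range (ternary_partial S))
    (ternary_partial S n + 3 / 2 * 3^-1 ^+ n).
  move=> _ [m _ <-]; have pos k : 0 <= (3^-1 : R) ^+ k
    by rewrite exprn_ge0// invr_ge0.
  have [/subnKC <-|/ltnW /subnKC mn] := leqP n m.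
    have /andP[_] := ternary_partial_tail S n (m - n).
    have := pos (n + (m - n))%N; move: (ternary_partial _ _) => *; lra.
  have /andP[+ _] := ternary_partial_tail S m (n - m); rewrite mn.
  have := pos n; move: (ternary_partial _ _) => *; lra.
apply/andP; split.
  by apply: ub_le_sup; [exists (ternary_partial S n + 3 / 2 * 3^-1 ^+ n)|exists n].
by apply: ge_sup => //; exists (ternary_partial S 0); exists 0%N.
Qed.

Lemma ternary_inj : injective ternary.
Proof.
(* at the first place [n] where [S] and [S'] differ, the larger sum is ahead by
   [3^-n], while all later terms of the other one add up to at most [3^-n / 2] *)
have key S S' n : ternary S = ternary S' -> (forall m, (m < n)%N -> (S m <-> S' m)) ->
    S n -> S' n.
  move=> SS' eqn Sn; apply: contrapT => S'n.
  have partE : ternary_partial S n = ternary_partial S' n.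
    by apply: eq_bigl => i; apply/asboolP/asboolP => /eqn; apply.
  have /andP[+ _] := ternary_bounds S n.+1.
  have /andP[_] := ternary_bounds S' n.+1.
  rewrite SS' !ternary_partialS (asboolT Sn) (asboolF S'n) partE exprS.
  have : 0 < (3^-1 : R) ^+ n by rewrite exprn_gt0// invr_gt0.
  move: (3^-1 ^+ n) (ternary S') (ternary_partial S' n) => *; lra.
move=> S S' SS'; apply/seteqP.
have all_eq n : S n <-> S' n.
  elim/ltn_ind: n => n IH; split; apply: key => // m mn.
  by split=> /(IH m mn).
by split=> n /all_eq.
Qed.

Lemma set_countable_inj (Q : countType) : exists F : set Q -> R, injective F.
Proof.
exists (fun S => ternary [set pickle x | x in S]) => S S' /ternary_inj /seteqP[h1 h2].
apply/seteqP; split=> x Sx.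
  by have [|y Sy /(pcan_inj pickleK) <-//] := h1 (pickle x); exists x.
by have [|y Sy /(pcan_inj pickleK) <-//] := h2 (pickle x); exists x.
Qed.

Lemma lower_rat_inj : injective (fun x : R => [set r : rat | ratr r < x]).
Proof.
have key (x y : R) : [set r : rat | ratr r < x] = [set r : rat | ratr r < y] -> ~ x < y.
  move=> /seteqP[_ h] /rat_in_itvoo[r]; rewrite in_itv/= => /andP[xr ry].
  by have /= := h r ry; rewrite ltNge (ltW xr).
by move=> x y xy; apply/eqP; case: ltgtP => // /key; case.
Qed.

(** A scalar amounts to one or two reals and a real to its lower rational cut, so an array is coded
    by one subset of the countable type [nat * nat * bool * rat]. *)
Lemma nat2_KK_inj (b : bool) : exists F : (nat -> nat -> KK R b) -> R, injective F.
Proof.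
have [p p_inj] : exists p : KK R b -> bool -> R, injective p.
  case: b; first by exists (fun x _ => x) => x y /(congr1 (fun f => f true)).
  exists (fun x c => if c then complex.Re x else complex.Im x) => -[x1 x2] [y1 y2] xy.
  by have /= -> := congr1 (fun f => f true) xy; have /= -> := congr1 (fun f => f false) xy.
have [F F_inj] := set_countable_inj (nat * nat * bool * rat)%type.
exists (fun a => F [set z | ratr z.2 < p (a z.1.1.1 z.1.1.2) z.1.2]).
move=> a a' /F_inj /seteqP[h1 h2].
apply/funext => m; apply/funext => n; apply/p_inj/funext => c.
apply/lower_rat_inj/seteqP; split=> r; first exact: (h1 (m, n, c, r)).
exact: (h2 (m, n, c, r)).
Qed.

End ContinuumCard.

(** * Linear independence and extension to Hamel bases *)

Section LinearIndependence.
Variables (K : fieldType) (T : lmodType K).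

Definition lin_indep (B : set T) : Prop :=
  forall (s : seq T) (c : T -> K), uniq s -> (forall x, x \in s -> B x) ->
    \sum_(x <- s) c x *: x = 0 -> forall x, x \in s -> c x = 0.

Definition in_span (B : set T) (x : T) : Prop :=
  exists (s : seq T) (c : T -> K),
    (forall y, y \in s -> B y) /\ x = \sum_(y <- s) c y *: y.

Lemma in_span_mem (B : set T) x : B x -> in_span B x.
Proof.
move=> Bx; exists [:: x], (fun=> 1); split; last by rewrite big_seq1 scale1r.
by move=> y; rewrite inE => /eqP ->.
Qed.

Lemma lin_indep_adjoin (B : set T) x :
  lin_indep B -> ~ in_span B x -> lin_indep (x |` B).
Proof.
move=> indB xB s c us sB s0.
have [xs|xs] := boolP (x \in s); last first.
  by apply: indB => // y ys; case: (sB y ys) => // yx; move: ys; rewrite yx (negPf xs).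
have remB y : y \in rem x s -> B y.
  rewrite mem_rem_uniq// inE => /andP[/eqP yx ys].
  by case: (sB y ys).
move: s0; rewrite (big_rem x)//= => s0.
have cx0 : c x = 0.
  apply: contrapT => /eqP cx; apply: xB.
  exists (rem x s), (fun y => - (c x)^-1 * c y); split=> //.
  under eq_bigr do rewrite -scalerA.
  rewrite -scaler_sumr; move/eqP: s0; rewrite addrC addr_eq0 => /eqP ->.
  by rewrite scalerN scaleNr opprK scalerA mulVf// scale1r.
move: s0; rewrite cx0 scale0r add0r => s0 y ys.
have [->//|yx] := eqVneq y x.
by apply: (indB (rem x s)) => //; rewrite ?rem_uniq// mem_rem_uniq// inE yx.
Qed.

Lemma lin_indep_chain (H : set T) (F : set (set T)) :
  lin_indep H -> (forall Y, F Y -> lin_indep (Y `|` H)) -> total_on F subset ->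
  lin_indep (\bigcup_(Y in F) Y `|` H).
Proof.
move=> indH indF totF s c us sF.
(* Only finitely many vectors occur, so a single member of the chain holds all those outside [H];
   [set0] serves when there are none. *)
have [Y [FY sY]] : exists Y, (F Y \/ Y = set0) /\ forall x, x \in s -> (Y `|` H) x.
  elim: s {us} sF => [_|x s IH sF]; first by exists set0; split=> //; right.
  have [|Y [FY sY]] := IH; first by move=> y ys; apply: sF; rewrite inE ys orbT.
  case: (sF x (mem_head x s)) => [[Z FZ Zx]|Hx]; last first.
    by exists Y; split=> // y; rewrite inE => /orP[/eqP ->|/sY//]; right.
  have [YZ|ZY] : Y `<=` Z \/ Z `<=` Y.
    by case: FY => [FY|->]; [exact: totF|left].
  - exists Z; split; first by left.
    move=> y; rewrite inE => /orP[/eqP ->|/sY[/YZ|]]; by [left|right].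
  - exists Y; split=> // y; rewrite inE => /orP[/eqP ->|/sY//]; left; exact: ZY.
apply: (_ : lin_indep (Y `|` H)) => //.
by case: FY => [/indF//|->]; rewrite set0U.
Qed.

(** Zorn's lemma runs over the sets whose union with [H] is independent, not over the sets
    containing [H], so that the empty chain also has an admissible union. *)
Lemma hamel_basis_extend (X H : set T) : lin_indep H -> H `<=` X ->
  exists B, [/\ H `<=` B, B `<=` X, lin_indep B & X `<=` in_span B].
Proof.
move=> indH HX.
have [F FP totF|B0 [[B0X indB0] maxB0]] :=
    @Zorn_bigcup T [set B | B `<=` X /\ lin_indep (B `|` H)].
  split; first by move=> x [Y /FP[YX _] /YX].
  by apply: lin_indep_chain => // Y /FP[].
exists (B0 `|` H); split=> //.
- by move=> x [/B0X|/HX].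
move=> x Xx; apply: contrapT => xB.
apply: (maxB0 (x |` B0)).
  split; first by move=> y; right.
  by move=> /(_ x (or_introl erefl)) B0x; apply/xB/in_span_mem; left.
split; first by move=> y [->|/B0X].
by rewrite -setUA; exact: lin_indep_adjoin.
Qed.

Section Families.
Variables (I : choiceType) (e : I -> T).
Hypothesis e_inj : injective e.

Lemma range_seq (s : seq T) : (forall x, x \in s -> range e x) ->
  exists s' : seq I, s = map e s'.
Proof.
elim: s => [_|x s IH se]; first by exists [::].
have [|s' ->] := IH; first by move=> y ys; apply: se; rewrite inE ys orbT.
by have [i _ <-] := se x (mem_head _ _); exists (i :: s').
Qed.

Lemma lin_indep_family : lin_indep (range e) <->
  forall (s : seq I) (c : I -> K), uniq s ->
    \sum_(i <- s) c i *: e i = 0 -> forall i, i \in s -> c i = 0.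
Proof.
split=> [ind s c us s0 i si|ind s c us se].
  (* A left inverse of [e] turns coefficients indexed by [I] into coefficients indexed by vectors;
     [i] is its default value off the range. *)
  have [g ge] : exists g : T -> I, cancel e g.
    exists (fun x => xget i [set j | e j = x]) => j.
    by case: xgetP => [k _ /e_inj//|/(_ j)]; case.
  rewrite -(ge i); apply: (ind (map e s) (c \o g)); rewrite ?map_inj_uniq ?map_f//.
    by move=> _ /mapP[j _ ->]; exists j.
  by rewrite big_map; apply: etrans s0; apply: eq_bigr => j _; rewrite /= ge.
have [s' sE] := range_seq se; move: us; rewrite sE map_inj_uniq// big_map => us s0.
by move=> _ /mapP[i si ->]; exact: (ind s' (c \o e)).
Qed.

Lemma in_span_range x : in_span (range e) x ->
  exists (s : seq I) (c : I -> K), x = \sum_(i <- s) c i *: e i.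
Proof. by move=> [s [c [/range_seq[s' ->] ->]]]; exists s', (c \o e); rewrite big_map. Qed.

End Families.
End LinearIndependence.

(** * The modulus and the embedding of the reals into the scalars *)

Section Scalars.
Variables (R : realType) (b : bool).

Lemma modK_ge0 (l : KK R b) : 0 <= modK l.
Proof. by move: l; case: b => [x|[x y]] /=; rewrite ?normr_ge0 ?sqrtr_ge0. Qed.

Lemma modKN1 : modK (-1 : KK R b) = 1.
Proof.
case: b => /=; first by rewrite normrN1.
by rewrite oppr0 expr0n/= addr0 sqrrN expr1n sqrtr1.
Qed.

Definition realK : R -> KK R b :=
  match b return R -> KK R b with
  | true => id
  | false => fun x => Complex x 0
  end.

Lemma realK_inj : injective realK.
Proof. by rewrite /realK; case: b => [x y|x y []]. Qed.

Lemma modK_realX (t : R) n : 0 <= t -> modK (realK t ^+ n) = t ^+ n.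
Proof.
rewrite /realK; case: b => t0 /=; first by rewrite ger0_norm// exprn_ge0.
have -> : (Complex t 0 : R[i]) ^+ n = Complex (t ^+ n) 0.
  by rewrite -[Complex t 0]/(real_complex R t) -rmorphXn.
by rewrite expr0n/= addr0 sqrtr_sqr ger0_norm// exprn_ge0.
Qed.

End Scalars.

(** * Closures and geometric series in a q-normed space *)

Section QNorm.
Variables (R : realType) (b : bool).
Local Notation K := (KK R b).
Variables (T : lmodType K) (P : set T) (q : R) (nrm : T -> R).
Hypotheses (q0 : 0 < q) (subP : is_subspace P) (normP : is_qnorm P q nrm).

Lemma subspaceB x y : P x -> P y -> P (x - y).
Proof. by case: subP => _ [D Z] Px Py; apply: D => //; rewrite -scaleN1r; exact: Z. Qed.

Lemma subspace_sum (I : Type) (s : seq I) (Q : pred I) (c : I -> K) (g : I -> T) :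
  (forall i, P (g i)) -> P (\sum_(i <- s | Q i) c i *: g i).
Proof. by case: subP => P0 [D Z] Pg; apply: big_ind => // i _; exact: Z. Qed.

Lemma qnorm_ge0 x : P x -> 0 <= nrm x.
Proof. by case: normP => + _; exact. Qed.

Lemma qnorm0 : nrm 0 = 0.
Proof. by case: normP => _ [/(_ 0) [|_ ->]] //; case: subP. Qed.

Lemma qnormN x : P x -> nrm (- x) = nrm x.
Proof.
by case: normP => _ [_ [nZ _]] Px; rewrite -scaleN1r nZ// modKN1 mul1r.
Qed.

Lemma qnorm_subC x y : P x -> P y -> nrm (x - y) = nrm (y - x).
Proof. by move=> Px Py; rewrite -opprB qnormN//; exact: subspaceB. Qed.

Lemma qnorm_add_small (e : R) : 0 < e -> exists2 d : R, 0 < d &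
  forall x y, P x -> P y -> nrm x < d -> nrm y < d -> nrm (x + y) < e.
Proof.
move=> e0; have eq0 : 0 < e `^ q / 2 by rewrite divr_gt0// powR_gt0.
(* Only q-th powers are subadditive, so the usual halving of [e] is done on [e] to the power [q]. *)
exists ((e `^ q / 2) `^ q^-1); first by rewrite powR_gt0.
have small x : P x -> nrm x < (e `^ q / 2) `^ q^-1 -> nrm x `^ q < e `^ q / 2.
  move=> Px xd; suff: nrm x `^ q < ((e `^ q / 2) `^ q^-1) `^ q.
    by rewrite -powRrM mulVf ?lt0r_neq0// powRr1// ltW.
  by apply: gt0_ltr_powR => //; rewrite nnegrE ?powR_ge0 ?qnorm_ge0.
move=> x y Px Py /(small x Px) xd /(small y Py) yd; rewrite ltNge; apply/negP => exy.
have : e `^ q <= nrm (x + y) `^ q.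
  by apply: ge0_ler_powR => //; rewrite ?nnegrE ?ltW// (lt_le_trans e0).
have [_ [_ [_ /(_ x y Px Py)]]] := normP.
move: (powR (nrm (x + y)) q) (powR (nrm x) q) (powR (nrm y) q) (powR e q) xd yd.
move=> *; lra.
Qed.

Lemma qnorm_small_eq0 x : P x -> (forall e : R, 0 < e -> nrm x < e) -> x = 0.
Proof.
move=> Px small; have [_ [/(_ x Px) [h _] _]] := normP; apply: h.
apply/eqP; rewrite eq_le qnorm_ge0// andbT leNgt; apply/negP => /small.
by rewrite ltxx.
Qed.

Definition qclosure (S : set T) : set T :=
  [set x | P x /\ forall e : R, 0 < e -> exists2 y, S y & nrm (y - x) < e].

Section Closure.
Variable S : set T.
Hypotheses (SP : S `<=` P) (subS : is_subspace S).

Lemma qclosure_subset : S `<=` qclosure S.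
Proof.
by move=> x Sx; split; [exact: SP|move=> e e0; exists x; rewrite ?subrr ?qnorm0].
Qed.

Lemma qclosure_subspace : is_subspace (qclosure S).
Proof.
have [S0 [SD SZ]] := subS; have [P0 [PD PZ]] := subP.
split; [|split].
- exact: qclosure_subset.
- move=> x y [Px clx] [Py cly]; split; first exact: PD.
  move=> e /qnorm_add_small[d d0 addd].
  have [x' Sx' xd] := clx d d0; have [y' Sy' yd] := cly d d0.
  exists (x' + y'); first exact: SD.
  by rewrite opprD addrACA; apply: addd => //; apply: subspaceB => //; exact: SP.
- move=> l x [Px clx]; split; first exact: PZ.
  (* Adding 1 keeps the divisor positive when [l] is 0. *)
  move=> e e0; have l1 : 0 < modK l + 1 by rewrite ltr_wpDl// modK_ge0.
  have [|x' Sx' xd] := clx (e / (modK l + 1)); first by rewrite divr_gt0.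
  exists (l *: x'); first exact: SZ.
  have Pxx : P (x' - x) by apply: subspaceB => //; exact: SP.
  have [_ [_ [nZ _]]] := normP; rewrite -scalerBr nZ//.
  rewrite ltr_pdivlMr// in xd; apply: le_lt_trans xd.
  by rewrite mulrC ler_wpM2l ?qnorm_ge0// lerDl.
Qed.

Lemma qclosure_closed (u : nat -> T) y : (forall n, qclosure S (u n)) -> P y ->
  (forall e : R, 0 < e -> exists N : nat, forall n : nat, (N <= n)%N -> nrm (u n - y) < e) ->
  qclosure S y.
Proof.
move=> clu Py uy; split=> // e /qnorm_add_small[d d0 addd].
have [N /(_ N (leqnn N)) uN] := uy d d0; have [PuN /(_ d d0) [z Sz zu]] := clu N.
exists z => //; rewrite -(subrKA (u N)).
by apply: addd => //; apply: subspaceB => //; exact: SP.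
Qed.

End Closure.

(** The q-th powers of the norms of the terms are at most [C] to the [q] times the powers of [t] to
    the [q], a ratio below 1. So the partial sums are Cauchy. *)
Lemma geometric_series_cvg (g : nat -> T) (C t : R) :
  is_complete P nrm -> (forall n, P (g n)) -> (forall n, nrm (g n) <= C) ->
  0 < t < 1 ->
  exists2 h, P h & forall e : R, 0 < e -> exists N : nat, forall n : nat, (N <= n)%N ->
    nrm (\sum_(i < n) realK b t ^+ i *: g i - h) < e.
Proof.
move=> complP Pg gC /andP[t0 t1].
pose u n := \sum_(i < n) realK b t ^+ i *: g i.
have Pu n : P (u n) by exact: subspace_sum.
set s := t `^ q; set D := C `^ q.
have s0 : 0 < s by rewrite powR_gt0.
have D0 : 0 <= D by rewrite powR_ge0.
have C0 : 0 <= C by rewrite (le_trans _ (gC 0))// qnorm_ge0.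
have s1 : s < 1.
  suff : s < 1 `^ q by rewrite powR1.
  by apply: gt0_ltr_powR => //; rewrite nnegrE ?ltW.
have tail m k : nrm (u (m + k)%N - u m) `^ q <= D * (s ^+ m - s ^+ (m + k)) / (1 - s).
  elim: k => [|k IH].
    by rewrite addn0 !subrr qnorm0 mulr0 mul0r powR0// gt_eqF.
  have [_ [_ [nZ nD]]] := normP.
  rewrite addnS /u big_ord_recr/= -/(u (m + k)) addrAC.
  apply: le_trans (nD _ _ _ _) _; first exact: (subspaceB (Pu _) (Pu _)).
    by case: subP => _ [_ Z]; exact: Z.
  have t0' := ltW t0; rewrite nZ// modK_realX// powRM ?exprn_ge0 ?qnorm_ge0//.
  have -> : (t ^+ (m + k)) `^ q = s ^+ (m + k).
    by rewrite -!powR_mulrn ?powR_ge0 ?ltW// powRAC.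
  have : s ^+ (m + k) * nrm (g (m + k)%N) `^ q <= s ^+ (m + k) * D.
    apply: ler_wpM2l; first by rewrite exprn_ge0// ltW.
    by apply: ge0_ler_powR; rewrite ?nnegrE ?qnorm_ge0// ltW.
  move: IH; rewrite exprS; move: (s ^+ (m + k)) (s ^+ m) => x y h1 h2.
  apply: le_trans (lerD h1 h2) _.
  rewrite le_eqVlt; apply/orP; left; apply/eqP.
  by field; rewrite subr_eq0 gt_eqF.
have [h [Ph uh]] : exists h, P h /\ forall e : R, 0 < e -> exists N : nat, forall n : nat,
    (N <= n)%N -> nrm (u n - h) < e; last by exists h.
apply: complP => // e e0.
have [N sN] : exists N, forall m, (N <= m)%N -> D * s ^+ m / (1 - s) < e `^ q.
  have ss : `|s| < 1 by rewrite ger0_norm// ltW.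
  (* The divisor [D + 1] replaces [D], which may be 0. *)
  have /cvgrPdist_lt /(_ (e `^ q * (1 - s) / (D + 1)))[|N _ hN] := cvg_expr ss.
    by rewrite !(divr_gt0, mulr_gt0) ?powR_gt0 ?subr_gt0// ltr_wpDl.
  exists N => m /hN /=; rewrite sub0r normrN => /(le_lt_trans (ler_norm _)).
  rewrite ltr_pdivlMr ?ltr_wpDl// => sm.
  rewrite ltr_pdivrMr ?subr_gt0//; apply: le_lt_trans sm.
  by rewrite mulrC ler_wpM2l ?exprn_ge0 ?lerDl// ltW.
exists N.
have main m k : (N <= m)%N -> nrm (u (m + k)%N - u m) < e.
  move=> /sN sm; rewrite ltNge; apply/negP => eu.
  have : e `^ q <= nrm (u (m + k)%N - u m) `^ q.
    by apply: ge0_ler_powR; rewrite ?nnegrE ?(ltW q0) ?(ltW e0) ?qnorm_ge0//; apply: subspaceB.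
  apply/negP; rewrite -ltNge; apply: (le_lt_trans (tail m k)); apply: le_lt_trans sm.
  rewrite ler_pM2r ?invr_gt0 ?subr_gt0// ler_wpM2l// gerDl oppr_le0.
  by rewrite exprn_ge0// ltW.
move=> m n Nm Nn; have [mn|/ltnW nm] := leqP m n.
  by rewrite qnorm_subC// -(subnKC mn); exact: main.
by rewrite -(subnKC nm); exact: main.
Qed.

End QNorm.

(** * Spans of sequences and the size of their closures *)

Section SeqSpan.
Variables (R : realType) (b : bool).
Local Notation K := (KK R b).
Variable T : lmodType K.
Implicit Type g : nat -> T.

Definition seq_span g : set T :=
  [set x | exists (M : nat) (c : nat -> K), x = \sum_(i < M) c i *: g i].

(** Padding with zero coefficients brings two combinations to a common length before they are
    added. *)
Lemma seq_span_widen g (M k : nat) (c : nat -> K) :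
  \sum_(i < M) c i *: g i = \sum_(i < M + k) (if (i < M)%N then c i else 0) *: g i.
Proof.
rewrite big_split_ord/= [X in _ + X]big1 ?addr0; last first.
  by move=> i _; rewrite ltnNge leq_addr/= scale0r.
by apply: eq_bigr => i _; rewrite ltn_ord.
Qed.

Lemma seq_span_subspace g : is_subspace (seq_span g).
Proof.
split; [|split].
- by exists 0%N, (fun=> 0); rewrite big_ord0.
- move=> _ _ [M [c ->]] [M' [c' ->]].
  rewrite (seq_span_widen g M M') (seq_span_widen g M' M) (addnC M') -big_split/=.
  exists (M + M')%N,
    (fun i => (if (i < M)%N then c i else 0) + (if (i < M')%N then c' i else 0)).
  by apply: eq_bigr => i _; rewrite scalerDl.
- move=> l _ [M [c ->]]; exists M, (fun i => l * c i).
  by rewrite scaler_sumr; apply: eq_bigr => i _; rewrite scalerA.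
Qed.

Lemma seq_span_mem g n : seq_span g (g n).
Proof.
exists n.+1, (fun i => (i == n)%:R).
rewrite big_ord_recr/= eqxx scale1r big1 ?add0r// => i _.
by rewrite ltn_eqF// scale0r.
Qed.

Variables (P : set T) (q : R) (nrm : T -> R).
Hypotheses (q0 : 0 < q) (subP : is_subspace P) (normP : is_qnorm P q nrm).

(* choosing for each point approximations by finite linear combinations, the
   point is determined by the array of their lengths and coefficients *)
Lemma qclosure_seq_span_inj g : (forall n, P (g n)) ->
  exists F : T -> R, {in qclosure P nrm (seq_span g) &, injective F}.
Proof.
move=> Pg.
have PS x : seq_span g x -> P x by move=> [M [c ->]]; exact: subspace_sum.
have /choice[a aP] : forall xn : T * nat, exists Mc : nat * (nat -> K),
    qclosure P nrm (seq_span g) xn.1 ->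
    nrm (\sum_(i < Mc.1) Mc.2 i *: g i - xn.1) < (xn.2.+1%:R)^-1.
  move=> [x n]; have [[_ /(_ (n.+1%:R^-1))[|y [M [c ->]] yx]]|nclx] :=
      pselect (qclosure P nrm (seq_span g) x); first by rewrite invr_gt0.
    by exists (M, c).
  by exists (0%N, fun=> 0).
have [F F_inj] := nat2_KK_inj R b.
(* Row [n] stores the length of the n-th approximation at place 0 and its coefficients shifted by
   one; the length can be read back because the characteristic is 0. *)
exists (fun x => F (fun n i => if i is i'.+1 then (a (x, n)).2 i' else (a (x, n)).1%:R)).
move=> x y /[!inE] clx cly /F_inj xy.
have {}xy n : a (x, n) = a (y, n).
  have {}xy i := congr1 (fun f => f n i) xy.
  have := xy 0%N => /eqP; rewrite eqr_nat.
  case: (a (x, n)) (a (y, n)) xy => M c [M' c'] /= xy /eqP ->; congr pair.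
  by apply/funext => i; exact: (xy i.+1).
apply/eqP; rewrite -subr_eq0; apply/eqP.
have [Px _] := clx; have [Py _] := cly.
apply: (qnorm_small_eq0 normP); first exact: subspaceB.
move=> e /(qnorm_add_small q0 normP)[d d0 addd].
have [n nd] : exists n, n.+1%:R^-1 < d.
  have [n _ /(_ n (leqnn n)) nd] := near_infty_natSinv_lt (PosNum d0).
  by exists n.
(* Equal codes give equal approximations, so this one point is close to both [x] and [y]. *)
set z := \sum_(i < (a (x, n)).1) (a (x, n)).2 i *: g i.
have Pz : P z by exact: subspace_sum.
rewrite -(subrKA z); apply: addd; try exact: subspaceB.
  by rewrite (qnorm_subC subP normP)//; apply: lt_trans nd; exact: (aP (x, n)).
by apply: lt_trans nd; rewrite /z xy; exact: (aP (y, n)).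
Qed.

End SeqSpan.

(** * Hamel bases indexed by the reals *)

Section HamelDimension.
Variables (R : realType) (b : bool) (T : lmodType (KK R b)).

(** By Cantor-Bernstein: a basis extending the range of [h] is at least as large as [R], and as a
    subset of [X] it injects into [R]. *)
Lemma continuum_hamel_basis (X : set T) (h : R -> T) :
  is_subspace X -> (exists F : T -> R, {in X &, injective F}) ->
  injective h -> range h `<=` X -> lin_indep (range h) ->
  exists e : R -> T,
    injective e /\
    (forall (s : seq R) (c : R -> KK R b), uniq s ->
       \sum_(i <- s) c i *: e i = 0 -> forall i, i \in s -> c i = 0) /\
    (forall x, X x <-> exists (s : seq R) (c : R -> KK R b), x = \sum_(i <- s) c i *: e i).
Proof.
move=> subX [F F_inj] h_inj hX hind.
have [B [hB BX indB spanB]] := hamel_basis_extend hind hX.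
have /(@card_set_bijP _ R^o)[f [_ f_inj f_surj]] : (B #= [set: R])%card.
  rewrite card_eq_le; apply/andP; split.
    apply: card_le_trans (subset_card_le BX) _.
    by apply/(@pcard_injP _ R^o); exists F.
  apply: card_le_trans (subset_card_le hB).
  have : (range h #= [set: R])%card by apply: inj_card_eq => ? ? _ _; exact: h_inj.
  by rewrite card_eq_le => /andP[].
have /choice[e eP] : forall r : R, exists x, B x /\ f x = r.
  by move=> r; have [x Bx <-] := f_surj r I; exists x.
have e_inj : injective e.
  by move=> r r' /(congr1 f); rewrite (eP r).2 (eP r').2.
have eB : range e = B.
  apply/seteqP; split=> [_ [r _ <-]|x Bx]; first by have [] := eP r.
  exists (f x) => //; have [Be fe] := eP (f x).
  by apply: f_inj; rewrite ?inE.
exists e; split => //; split; first by apply/lin_indep_family => //; rewrite eB.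
move=> x; split=> [Xx|[s [c ->]]].
  by apply: in_span_range; rewrite eB; exact: spanB.
by apply: subspace_sum => // r; apply: BX; have [] := eP r.
Qed.

End HamelDimension.

(** * Spreading operators and coordinates of limits *)

Section Spread.
Variables (R : realType) (b : bool) (W : lmodType (KK R b)).

(* for increasing [j] every preimage of [k] is at most [k], so the sum has at
   most one term *)
Definition spread (j : nat -> nat) (a : nat -> W) : nat -> W :=
  fun k => \sum_(i < k.+1 | j i == k) a i.

Lemma spreadD j (x y : nat -> W) : spread j (x + y) = spread j x + spread j y.
Proof. by apply/funext => k; exact: big_split. Qed.

Lemma spreadZ j l (x : nat -> W) : spread j (l *: x) = l *: spread j x.
Proof. by apply/funext => k; apply/esym/scaler_sumr. Qed.

Lemma spreadB j (x y : nat -> W) : spread j (x - y) = spread j x - spread j y.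
Proof. by rewrite -scaleN1r spreadD spreadZ scaleN1r. Qed.

Lemma spread_notin j a k : (forall i, j i <> k) -> spread j a k = 0.
Proof. by move=> jk; rewrite /spread big_pred0// => i; apply/eqP/jk. Qed.

Lemma spread_in j a i : {homo j : m n / (m < n)%N} -> spread j a (j i) = a i.
Proof.
move=> j_inc; have ij : (i < (j i).+1)%N.
  by rewrite ltnS; elim: i => // i /leq_ltn_trans; apply; exact: j_inc.
have j_inj : injective j.
  by move=> m n jmn; case: (ltngtP m n) => // /j_inc; rewrite jmn ltnn.
rewrite /spread (big_pred1 (Ordinal ij))// => k /=.
by rewrite -val_eqE/= (inj_eq j_inj).
Qed.

Variables (q : R) (V : set (nat -> W)) (nV : (nat -> W) -> R).
Hypotheses (q0 : 0 < q) (hV : spreading_qspace q V nV).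

Lemma spread_bounded j a : {homo j : m n / (m < n)%N} -> V a ->
  V (spread j a) /\ nV (spread j a) <= nV a.
Proof.
move=> j_inc Va; have [_ /(_ a Va j)] := hV; apply.
- by move=> i; exact: j_inc.
- by move=> i; rewrite spread_in.
- exact: spread_notin.
Qed.

Lemma spread_operator j : {homo j : m n / (m < n)%N} ->
  bounded_linear_op V nV (spread j) /\ opnorm V nV (spread j) <= 1.
Proof.
move=> j_inc.
have ub1 : ubound [set nV (spread j x) | x in [set x | V x /\ nV x <= 1]] 1.
  by move=> _ [x [Vx x1] <-]; apply: le_trans x1; case: (spread_bounded j_inc Vx).
split; [split; [|split; [|split]]|].
- by move=> x /(spread_bounded j_inc)[].
- by move=> x y _ _; exact: spreadD.
- by move=> l x _; exact: spreadZ.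
- by exists 1.
apply: ge_sup ub1; have [[[V0 _] _] _] := hV; have [[subV [normV _]] _] := hV.
exists (nV (spread j 0)); exists 0 => //; split=> //.
by rewrite (qnorm0 subV normV).
Qed.

(* [a k = 0] iff [a] has equal spreads along [2 i] and [2 i + (i == k)]; so the
   coordinate hyperplanes are closed, although [W] carries no topology *)
Lemma coord_limit v k w : V v ->
  (forall e : R, 0 < e -> exists x, [/\ V x, x k = w & nV (x - v) < e]) -> v k = w.
Proof.
move=> Vv lim; have [[subV [normV _]] _] := hV.
(* Doubling leaves the odd places free, so [j2] can move the single index [k] from [2k] to [2k + 1]
   and remain increasing. *)
pose j1 i := i.*2; pose j2 i := (i.*2 + (i == k))%N.
have j1_inc : {homo j1 : m n / (m < n)%N} by move=> m n; rewrite ltn_double.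
have j2_inc : {homo j2 : m n / (m < n)%N}.
  by rewrite /j2 => m n mn; case: (m == k); case: (n == k); lia.
pose D a := spread j1 a - spread j2 a.
have DB x y : D (x - y) = D x - D y.
  by rewrite /D !spreadB !opprD addrACA.
have D0 a : a k = 0 -> D a = 0.
  move=> ak; apply/eqP; rewrite subr_eq0; apply/eqP/funext => n.
  rewrite /spread big_mkcond [RHS]big_mkcond; apply: eq_bigr => i _.
  rewrite /j1 /j2; have [ik|_] := eqVneq (i : nat) k; last by rewrite addn0.
  by rewrite ik ak !if_same.
have Dk a : D a k.*2 = a k.
  rewrite /D [LHS](_ : _ = spread j1 a (j1 k) - spread j2 a k.*2)//.
  rewrite spread_in// spread_notin ?subr0// => i.
  by rewrite /j2; case: eqVneq => [->|]; lia.
have [x1 [Vx1 x1k _]] := lim 1 ltr01.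
have VB x : V x -> V (x - v) by move=> Vx; exact: subspaceB.
have VD x : V x -> V (D x).
  by move=> Vx; apply: subspaceB => //; exact: (spread_bounded _ Vx).1.
have D10 : D (x1 - v) = 0.
  apply: (qnorm_small_eq0 normV); first exact/VD/VB.
  move=> e /(qnorm_add_small q0 normV)[d d0 addd].
  have [x [Vx xk xd]] := lim d d0.
  (* All approximants share the coordinate [w] at [k], so [D (x - v)] is the same for each of them
     and its norm is below every bound. *)
  have -> : D (x1 - v) = D (x - v).
    apply/eqP; rewrite -subr_eq0 -DB; apply/eqP/D0.
    by rewrite -[LHS]/(x1 k - v k - (x k - v k)) xk x1k subrr.
  have [V1 n1] := spread_bounded j1_inc (VB _ Vx).
  have [V2 n2] := spread_bounded j2_inc (VB _ Vx).
  apply: addd; rewrite ?(qnormN normV)//; try exact: le_lt_trans xd.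
  by rewrite -scaleN1r; case: subV => _ [_]; apply.
have : D (x1 - v) k.*2 = 0 by rewrite D10.
by rewrite Dk -[LHS]/(x1 k - v k) x1k => /eqP; rewrite subr_eq0 => /eqP.
Qed.

End Spread.

(** * Vanishing power sums, and a partition of the positive integers *)

Lemma power_sums_eq0 (K : fieldType) (I : eqType) (t : I -> K) (s : seq I) (c : I -> K) :
  injective t -> uniq s -> (forall n, \sum_(i <- s) c i * t i ^+ n = 0) ->
  forall i, i \in s -> c i = 0.
Proof.
move=> t_inj us s0.
(* By linearity the relation passes from powers to all polynomials. *)
have poly0 p : \sum_(i <- s) c i * p.[t i] = 0.
  under eq_bigr do rewrite horner_coef big_distrr/=.
  rewrite exchange_big/= big1// => n _.
  under eq_bigr do rewrite mulrCA.
  by rewrite -big_distrr/= s0 mulr0.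
(* This polynomial vanishes at all the other parameters but not at [t i], which isolates [c i]. *)
move=> i si; have := poly0 (\prod_(k <- rem i s) ('X - (t k)%:P)).
rewrite (big_rem i)//= [X in _ + X]big1_seq ?addr0 => [/eqP|k /andP[_ ks]].
  rewrite mulf_eq0 => /orP[/eqP//|].
  rewrite horner_prod prodf_seq_eq0 => /hasP[k ks] /=.
  rewrite hornerXsubC subr_eq0 => /eqP /t_inj ik.
  by move: ks; rewrite mem_rem_uniq// inE ik eqxx.
rewrite horner_prod (big_rem k)//= hornerXsubC subrr mul0r mulr0//.
Qed.

Definition dyadic (n i : nat) : nat := (2 ^ n * (i.*2).+1)%N.

Lemma dyadic_inc n : {homo dyadic n : i j / (i < j)%N}.
Proof. by move=> i j ij; rewrite /dyadic ltn_pmul2l ?expn_gt0// ltnS ltn_double. Qed.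

(** The 2-adic valuation of [dyadic n i] is [n], so the value determines the class. *)
Lemma dyadic_disjoint m n i j : dyadic m i = dyadic n j -> m = n.
Proof.
have logn_dyadic k l : logn 2 (dyadic k l) = k.
  by rewrite lognM ?expn_gt0// pfactorK// logn_coprime ?addn0// coprime2n /= odd_double.
by move=> /(congr1 (logn 2)); rewrite !logn_dyadic.
Qed.

(** * The closed subspace through a given non-injective function *)

Section ClosedSubspace.
Variables (R : realType) (b : bool) (W : lmodType (KK R b)) (q : R).
Variables (V : set (nat -> W)) (nV : (nat -> W) -> R).
Variables (Om : Type) (A : set (Om -> nat -> W)) (nA : (Om -> nat -> W) -> R).
Hypotheses (q0 : 0 < q) (hV : spreading_qspace q V nV).
Hypothesis hA : stable_function_space q V nV A nA.

Lemma spread_comp f j : A f -> {homo j : m n / (m < n)%N} ->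
  A (spread j \o f) /\ nA (spread j \o f) <= nA f.
Proof.
move=> Af j_inc; have [_ [[subA [normA _]] [_ [_ /(_ f Af)stab]]]] := hA.
have [blo op1] := spread_operator hV j_inc; have [Aj nj] := stab _ blo.
by split=> //; apply: le_trans nj _; rewrite ler_piMl// (qnorm_ge0 normA).
Qed.

(** Evaluations at [w1] and [w2] are continuous on [A], so their agreement survives limits. *)
Lemma qclosure_eval_eq S w1 w2 h : S `<=` A -> (forall g, S g -> g w1 = g w2) ->
  qclosure A nA S h -> h w1 = h w2.
Proof.
move=> SA Sw [Ah clh]; have [AV [_ [_ [ev _]]]] := hA.
have [[subV [normV _]] _] := hV.
apply/eqP; rewrite -subr_eq0; apply/eqP/(qnorm_small_eq0 normV).
  by apply: (subspaceB subV); exact: AV.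
move=> e /(qnorm_add_small q0 normV)[d d0 addd].
have [d1 [d10 ev1]] := ev w1 h Ah d d0; have [d2 [d20 ev2]] := ev w2 h Ah d d0.
have [|g Sg gd] := clh (Num.min d1 d2); first by rewrite lt_min d10.
move: gd; rewrite lt_min => /andP[gd1 gd2].
have := ev1 g (SA g Sg) gd1; have := ev2 g (SA g Sg) gd2; rewrite -(Sw g Sg) => n2 n1.
have Vg := AV g (SA g Sg) w1; have Vh := AV h Ah.
rewrite -(subrKA (g w1)); apply: addd => //; try exact: (subspaceB subV).
by rewrite (qnorm_subC subV normV).
Qed.

Lemma spaceable_in_fiber (f : Om -> nat -> W) (w1 w2 : Om) :
  A f -> f <> 0 -> f w1 = f w2 ->
  exists X, [/\ closed_c_dim_subspace A nA X, X f & forall h, X h -> h w1 = h w2].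
Proof.
move=> Af f0 fw; have [AV [[subA [normA complA]] [_ [ev _]]]] := hA.
pose g0 n : Om -> nat -> W := spread (dyadic n) \o f.
(* Placing [f] at index 0 puts it in the span, while [g0] alone enters the series. *)
pose g n := if n is n'.+1 then g0 n' else f.
have Ag0 n : A (g0 n) by exact: (spread_comp Af (@dyadic_inc n)).1.
have Ag n : A (g n) by case: n.
have SA : seq_span g `<=` A by move=> _ [M [c ->]]; exact: subspace_sum.
have subS := seq_span_subspace g.
have subX := qclosure_subspace q0 subA normA SA subS.
exists (qclosure A nA (seq_span g)); split; last 1 first.
- move=> h; apply: qclosure_eval_eq => // _ [M [c ->]].
  rewrite !fct_sumE; apply/funext => k; apply: eq_bigr => i _.
  by case: (nat_of_ord i) => [|n] /=; rewrite /GRing.scale/= /g0/= fw.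
- split; first by move=> h [].
  split => //; split; first exact: (qclosure_closed q0 subA normA SA).
  have [w [k fwk]] : exists w k, f w k <> 0.
    apply: contrapT => nf; apply: f0; apply/funext => w; apply/funext => k.
    by apply: contrapT => fwk; apply: nf; exists w, k.
  (* An injection of the whole line into (0, 1), so that the series can be indexed by [R]. *)
  pose tau (r : R) := (1 + expR r)^-1.
  have tau_inj : injective tau by move=> r s /invr_inj /addrI /expR_inj.
  have tau01 r : 0 < tau r < 1.
    have := expR_gt0 r => e0; rewrite invr_gt0 addr_gt0//=.
    by rewrite invf_lt1 ?addr_gt0// ltrDl.
  have /choice[h hP] : forall r, exists h, A h /\ forall e : R, 0 < e ->
      exists N : nat, forall n : nat, (N <= n)%N ->
      nA (\sum_(i < n) realK b (tau r) ^+ i *: g0 i - h) < e.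
    move=> r; have g0f n : nA (g0 n) <= nA f.
      exact: (spread_comp Af (@dyadic_inc n)).2.
    by have [h Ah hr] := geometric_series_cvg q0 subA normA complA Ag0 g0f (tau01 r); exists h.
  have Xh r : qclosure A nA (seq_span g) (h r).
    have [Ah hr] := hP r; split=> // e /hr[N /(_ N (leqnn N)) hN].
    exists (\sum_(i < N) realK b (tau r) ^+ i *: g0 i) => //.
    by apply: subspace_sum => // i; exact: (seq_span_mem g i.+1).
  (* Disjointness of supports leaves only the m-th term at [dyadic m k], and [coord_limit] carries
     this value to the limit. *)
  have h_coord r m : h r w (dyadic m k) = realK b (tau r) ^+ m *: f w k.
    have [Ah hr] := hP r; apply: (coord_limit q0 hV); first exact: AV.
    move=> e e0; have [d [d0 evd]] := ev w (h r) Ah e e0.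
    (* The length must be at least [N] for closeness and exceed [m] for the m-th term to be
       present. *)
    have [N hN] := hr d d0; pose n := (N + m.+1)%N.
    exists ((\sum_(i < n) realK b (tau r) ^+ i *: g0 i) w); split.
    - by apply: AV; exact: subspace_sum.
    - rewrite !fct_sumE/=.
      have mn : (m < n)%N by rewrite /n addnS ltnS leq_addl.
      rewrite (bigD1 (Ordinal mn))//= big1 ?addr0 => [|i im].
        by congr (_ *: _); rewrite /g0/= spread_in//; exact: dyadic_inc.
      apply/eqP; rewrite scaler_eq0; apply/orP; right; apply/eqP.
      apply: spread_notin => l /dyadic_disjoint im'.
      by move: im; rewrite -val_eqE/= im' eqxx.
    - by apply: evd; [exact: subspace_sum|apply: hN; rewrite leq_addr].
  have h_inj : injective h.
    (* At [m = 1] the coordinate is [tau r] times the nonzero vector [f w k], so it determines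
       [r]. *)
    move=> r s rs; have := h_coord r 1%N; rewrite rs h_coord !expr1 => /eqP.
    rewrite -subr_eq0 -scalerBl scaler_eq0 subr_eq0 (introF eqP fwk) orbF.
    by move=> /eqP /realK_inj /tau_inj.
  apply: (continuum_hamel_basis subX _ h_inj).
  + exact: (qclosure_seq_span_inj q0 subA normA Ag).
  + by move=> _ [r _ <-].
  apply/lin_indep_family => // s c us s0.
  apply: (@power_sums_eq0 _ _ (realK b \o tau)) => // [r r' /realK_inj /tau_inj//|m].
  (* Reading the relation at [dyadic m k] gives the m-th power sum of the parameters, times
     [f w k]. *)
  have := congr1 (fun F => F w (dyadic m k)) s0; rewrite !fct_sumE/=.
  rewrite (eq_bigr (fun r => (c r * realK b (tau r) ^+ m) *: f w k)); last first.
    by move=> r _; rewrite -scalerA -h_coord.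
  rewrite -scaler_suml => /eqP; rewrite scaler_eq0 (introF eqP fwk) orbF.
  by move/eqP.
- by apply: (qclosure_subset subA normA SA); exact: (seq_span_mem g 0).
Qed.

End ClosedSubspace.

(** * The dichotomy for the set of non-injective functions *)

Theorem theorem3p3 (R : realType) (b : bool) (W : lmodType (KK R b))
  (q : R) (hq0 : 0 < q) (hq1 : q <= 1)
  (V : set (nat -> W)) (nV : (nat -> W) -> R)
  (hV : spreading_qspace q V nV) (hV0 : exists v, V v /\ v <> 0)
  (Om : Type) (hOm : inhabited Om)
  (A : set (Om -> nat -> W)) (nA : (Om -> nat -> W) -> R)
  (hA : stable_function_space q V nV A nA) :
  let N := [set f | A f /\ ~ injective f] in
  (N = [set 0]) \/
  (forall f, N f -> exists X : set (Om -> nat -> W),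
     closed_c_dim_subspace A nA X /\ X f /\ X `<=` N).
Proof.
move=> N.
have noninj (f : Om -> nat -> W) : ~ injective f -> exists w1 w2, f w1 = f w2 /\ w1 <> w2.
  move=> nf; apply: contrapT => all_inj; apply: nf => w1 w2 fw.
  by apply: contrapT => w12; apply: all_inj; exists w1, w2.
have spaceable f : N f -> f <> 0 -> exists X : set (Om -> nat -> W),
    closed_c_dim_subspace A nA X /\ X f /\ X `<=` N.
  move=> [Af /noninj[w1 [w2 [fw w12]]]] f0.
  have [X [cX Xf Xw]] := spaceable_in_fiber hq0 hV hA Af f0 fw.
  exists X; split=> //; split=> // h Xh; split; first by case: cX => /(_ h Xh).
  by move=> /(_ _ _ (Xw h Xh)).
have [[g [Ng g0]]|onlyN] := pselect (exists g, N g /\ g <> 0).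
  (* The zero function generates no useful space of its own; it lies in the one built from [g]. *)
  right=> f Nf; have [f0|/eqP f0] := eqVneq f 0; last exact: spaceable.
  have [X [cX [_ XN]]] := spaceable g Ng g0; exists X; split=> //; split=> //.
  by rewrite f0; case: cX => _ [[]].
(* An empty [N], as for a one-point [Om], satisfies the second alternative vacuously. *)
have [[f Nf]|emptyN] := pselect (exists f, N f); last first.
  by right=> f Nf; case: emptyN; exists f.
have only0 f' : N f' -> f' = 0.
  by move=> Nf'; apply: contrapT => f'0; apply: onlyN; exists f'.
left; apply/seteqP; split=> [f' /only0//|_ ->].
by rewrite -(only0 f Nf).
Qed.
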